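(* The satisfiability problem for sentences of $\mathcal{L}$ is decidable: there is an algorithm that, given a sentence $\alpha$, decides whether there exist a simplicial model $\mathcal{C}$ and a facet $F$ of $\mathcal{C}$ with $\mathcal{C},F\Vdash\alpha$.
   Context: Fix a nonempty finite set $\mathbf{A}$ of agents, a countable set $\mathbf{X}$ of variables disjoint from $\mathbf{A}$, and a countable set $\mathbf{P}$ of predicate letters. Formulas of $\mathcal{L}$ and free variables: $\phi ::= p_x \mid \top \mid \neg\phi \mid (\phi\wedge\phi) \mid [x:=a]\phi \mid \mathsf{K}_X\alpha$ ($p\in\mathbf{P}$, $x\in\mathbf{X}$, $a\in\mathbf{A}$, $X\subseteq\mathbf{X}$ finite possibly empty, $\alpha$ with no free variables), $FV(p_x)=\{x\}$, $FV(\top)=\emptyset$, $FV(\neg\phi)=FV(\phi)$, $FV(\phi\wedge\psi)=FV(\phi)\cup FV(\psi)$, $FV([x:=a]\phi)=FV(\phi)\setminus\{x\}$, $FV(\mathsf{K}_X\alpha)=X$. Sentences have no free variables. A simplicial model is $\mathcal{C}=(\mathcal{V},C,\chi,\ell)$: $\mathcal{V}\neq\emptyset$; $C\subseteq\wp(\mathcal{V})$ with $\emptyset\notin C$, closed under nonempty subsets, containing all singletons; $\chi:\mathcal{V}\to\mathbf{A}$ injective on each member of $C$; $\ell:\mathbf{P}\to\wp(\mathcal{V})$; facets $\mathcal{F}(C)$ are the inclusion-maximal members of $C$. Semantics, for assignments $\sigma:\mathbf{X}\to\mathbf{A}$ with $\sigma[FV(\phi)]\subseteq\chi[F]$ (Booleans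 standard): $\mathcal{C},F,\sigma\Vdash p_x$ iff $\sigma(x)\in\chi[F\cap\ell(p)]$; $\mathcal{C},F,\sigma\Vdash[x:=a]\phi$ iff ($a\in\chi[F]$ implies $\mathcal{C},F,\sigma[x\mapsto a]\Vdash\phi$); $\mathcal{C},F,\sigma\Vdash\mathsf{K}_X\alpha$ iff $\mathcal{C},G,\sigma\Vdash\alpha$ for all $G\in\mathcal{F}(C)$ with $\sigma[X]\subseteq\chi[F\cap G]$. Truth of a sentence is independent of $\sigma$; write $\mathcal{C},F\Vdash\alpha$. *)

(* Defs.v *)
From mathcomp Require Import all_boot.
Set Implicit Arguments.
Unset Strict Implicit.
Unset Printing Implicit Defensive.

(* Syntax.  Agents A = 'I_n (n >= 1), variables X = nat,             *)
(* predicate letters P = nat.  Finite sets X of variables in K_X are *)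
(* given as lists (only membership matters in the semantics).        *)
Inductive form (n : nat) : Type :=
| fPred : nat -> nat -> form n              (* fPred p x  =  p_x *)
| fTop : form n
| fNeg : form n -> form n
| fAnd : form n -> form n -> form n
| fAssign : nat -> 'I_n -> form n -> form n
| fK : list nat -> form n -> form n.

Arguments fTop {n}.

Fixpoint FV {n} (phi : form n) : list nat :=
  match phi with
  | fPred _ x => [:: x]
  | fTop => [::]
  | fNeg f => FV f
  | fAnd f g => FV f ++ FV g
  | fAssign x _ f => filter (fun y => negb (Nat.eqb y x)) (FV f)
  | fK X _ => X
  end.

Fixpoint wf {n} (phi : form n) : Prop :=
  match phi with
  | fPred _ _ => True
  | fTop => True
  | fNeg f => wf f
  | fAnd f g => wf f /\ wf g
  | fAssign _ _ f => wf f
  | fK _ a => wf a /\ FV a = [::]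
  end.

Definition is_sentence {n} (phi : form n) : Prop := wf phi /\ FV phi = [::].

Record simplicial_model (n : nat) : Type := SModel {
  vert : Type;
  simp : (vert -> Prop) -> Prop;
  chi : vert -> 'I_n;
  lab : nat -> vert -> Prop;
  vert_ne : inhabited vert;
  simp_nonempty : forall s, simp s -> exists v, s v;
  simp_down : forall s t, simp s -> (forall v, t v -> s v) ->
                (exists v, t v) -> simp t;
  simp_single : forall v, simp (fun u => u = v);
  chi_inj : forall s, simp s -> forall u v, s u -> s v -> chi u = chi v -> u = v
}.

Definition facet {n} (M : simplicial_model n) (F : vert M -> Prop) : Prop :=
  simp F /\ forall G, simp G -> (forall v, F v -> G v) -> forall v, G v -> F v.

Definition upd {n} (s : nat -> 'I_n) (x : nat) (a : 'I_n) : nat -> 'I_n :=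
  fun y => if Nat.eqb y x then a else s y.

Fixpoint sat {n} (M : simplicial_model n) (F : vert M -> Prop)
  (s : nat -> 'I_n) (phi : form n) : Prop :=
  match phi with
  | fPred p x => exists v, F v /\ lab p v /\ chi v = s x
  | fTop => True
  | fNeg f => ~ sat F s f
  | fAnd f g => sat F s f /\ sat F s g
  | fAssign x a f => (exists v, F v /\ chi v = a) -> sat F (upd s x a) f
  | fK X a => forall G, @facet n M G ->
       (forall x, x \in X -> exists v, F v /\ G v /\ chi v = s x) -> sat G s a
  end.

(* C, F ||- alpha for a sentence (truth independent of the assignment) *)
Definition satisfiable {n} (alpha : form n) : Prop :=
  exists (M : simplicial_model n) (F : vert M -> Prop),
    @facet n M F /\ forall s : nat -> 'I_n, sat F s alpha.

Inductive recf : Type :=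
| rZero : recf
| rSucc : recf
| rProj : nat -> recf
| rComp : recf -> list recf -> recf
| rPrec : recf -> recf -> recf
| rMu : recf -> recf.

Inductive eval : recf -> list nat -> nat -> Prop :=
| ev_zero v : eval rZero v 0
| ev_succ x v : eval rSucc (x :: v) (S x)
| ev_proj i v x : i < size v -> nth 0 v i = x -> eval (rProj i) v x
| ev_comp f gs v ws y : evals gs v ws -> eval f ws y -> eval (rComp f gs) v y
| ev_prec0 g h v y : eval g v y -> eval (rPrec g h) (0 :: v) y
| ev_precS g h k v z y : eval (rPrec g h) (k :: v) z ->
    eval h (k :: z :: v) y -> eval (rPrec g h) (S k :: v) y
| ev_mu f v k : eval f (k :: v) 0 ->
    (forall m, m < k -> exists j, eval f (m :: v) (S j)) -> eval (rMu f) v k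
with evals : list recf -> list nat -> list nat -> Prop :=
| evs_nil v : evals [::] v [::]
| evs_cons g gs v w ws : eval g v w -> evals gs v ws -> evals (g :: gs) v (w :: ws).

(* Goedel encoding of formulas via Cantor pairing                     *)
Definition cpair (a b : nat) : nat := Nat.div ((a + b) * (a + b + 1)) 2 + b.

Fixpoint enc_list (l : list nat) : nat :=
  match l with
  | [::] => 0
  | x :: l' => S (cpair x (enc_list l'))
  end.

Fixpoint enc {n} (phi : form n) : nat :=
  match phi with
  | fPred p x => cpair 0 (cpair p x)
  | fTop => cpair 1 0
  | fNeg f => cpair 2 (enc f)
  | fAnd f g => cpair 3 (cpair (enc f) (enc g))
  | fAssign x a f => cpair 4 (cpair x (cpair (nat_of_ord a) (enc f)))
  | fK X a => cpair 5 (cpair (enc_list X) (enc a))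
  end.

(* Main.v *)
(** A model is replaced by the set of the types of its facets, where a type
records the agents that are alive, the local atoms, and the truth values of
formulas with code below that of [alpha] under assignments to the variables
that can occur in it. Such a set satisfies local Hintikka-style conditions; the
only one that involves two types says that a refuted [K_X f] is refuted at the
type itself or at a type [u] that agrees with it on an agent set [B] containing
the values of [X], where [B] is a proper subset of the agents alive in either
type. Properness of [B] holds because a facet is not included in another one.

Conversely, a saturated set of types is unravelled into a tree of types whose
edges carry the sets [B]; two nodes share their vertex of colour [a] iff [a]
belongs to all labels on the path joining them. Properness of the labels makes
the resulting simplices pairwise non-included facets, and knowledge facts are
constant along the paths that matter for them.

A set of types is a number read in binary, of computable size, so that its
existence is a bounded-quantifier statement about [enc alpha]. *)

Require Import Defs.
From mathcomp Require Import all_boot.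
From Stdlib Require Import FunctionalExtensionality PropExtensionality Classical.
Set Implicit Arguments.
Unset Strict Implicit.
Unset Printing Implicit Defensive.

(** * Recursive functions and bounded formulas *)

(** Structural recursion on the code by [fix], because the components of a composition are nested in
    a list; that list needs its own inner induction. *)
Lemma eval_det : forall f v y z, eval f v y -> eval f v z -> y = z.
Proof.
fix IH 1; case=> [||i|f gs|g h|f] v y z.
- by move=> Ey; inversion Ey => Ez; inversion Ez.
- by move=> Ey; inversion Ey; subst => Ez; inversion Ez.
- by move=> Ey; inversion Ey; subst => Ez; inversion Ez.
- have IHs : forall ws ws', evals gs v ws -> evals gs v ws' -> ws = ws'.
    elim: gs => [|g gs IHgs] ws ws' E1 E2; inversion E1; inversion E2; subst=> //.
    by congr (_ :: _); [apply: IH; eassumption | apply: IHgs].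
  move=> Ey Ez; inversion Ey; inversion Ez; subst.
  have eq_ws : ws = ws0 by apply: IHs.
  by subst; apply: IH; eassumption.
- case: v => [|k v] Ey; first by inversion Ey.
  elim: k y z Ey => [|k IHk] y z Ey Ez; inversion Ey; inversion Ez; subst.
    by apply: IH; eassumption.
  have eq_z : z0 = z1 by apply: IHk.
  by subst; apply: IH; eassumption.
- move=> Ey Ez; inversion Ey as [| | | | | |? ? ? Ey0 Eylt];
    inversion Ez as [| | | | | |? ? ? Ez0 Ezlt]; subst.
  case: (ltngtP y z) => // [/Ezlt|/Eylt] [j Ej].
    by have := IH _ _ _ _ Ey0 Ej.
  by have := IH _ _ _ _ Ez0 Ej.
Qed.

(* A [k]-ary function is presented as a function of an environment of which
   only the first [k] values are passed; a binder shifts the environment. *)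
Definition computable (k : nat) (f : (nat -> nat) -> nat) : Prop :=
  exists d, forall env, eval d (mkseq env k) (f env).

Definition dec (k : nat) (P : (nat -> nat) -> Prop) : Prop :=
  exists2 b : (nat -> nat) -> bool, computable k (fun env => b env) &
    forall env, P env <-> b env.

Definition exb (b : nat) (P : nat -> Prop) := exists2 i, i < b & P i.
Definition allb (b : nat) (P : nat -> Prop) := forall i, i < b -> P i.

Definition push (i : nat) (env : nat -> nat) (j : nat) :=
  if j is j'.+1 then env j' else i.

Lemma mkseq_push i env k : mkseq (push i env) k.+1 = i :: mkseq env k.
Proof. by rewrite /mkseq /= -add1n iotaDl -map_comp. Qed.

Lemma comp_ext k f g : computable k g -> (forall env, f env = g env) -> computable k f.
Proof. by case=> d dP fg; exists d => env; rewrite fg. Qed.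

Lemma comp_var k i : i < k -> computable k (fun env => env i).
Proof.
move=> ik; exists (rProj i) => env.
by apply: ev_proj; rewrite ?size_mkseq ?nth_mkseq.
Qed.

Lemma evals_projs env k m : m <= k ->
  evals [seq rProj i | i <- iota (k - m) m] (mkseq env k)
    [seq env i | i <- iota (k - m) m].
Proof.
elim: m => [|m IHm] mk; first by constructor.
rewrite /=; constructor.
  by apply: ev_proj; rewrite ?size_mkseq ?nth_mkseq //; rewrite ltn_subrL (leq_trans _ mk).
have -> : (k - m.+1).+1 = k - m by rewrite subnS prednK // subn_gt0.
exact/IHm/ltnW.
Qed.

Lemma comp_app1 k f g : computable 1 (fun env => f (env 0)) -> computable k g ->
  computable k (fun env => f (g env)).
Proof.
move=> [d dP] [dg dgP]; exists (rComp d [:: dg]) => env.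
apply: (ev_comp (ws := [:: g env])).
  by repeat constructor.
exact: (dP (fun=> g env)).
Qed.

Lemma comp_app2 k f g h : computable 2 (fun env => f (env 0) (env 1)) -> computable k g ->
  computable k h -> computable k (fun env => f (g env) (h env)).
Proof.
move=> [d dP] [dg dgP] [dh dhP]; exists (rComp d [:: dg; dh]) => env.
apply: (ev_comp (ws := [:: g env; h env])).
  by repeat constructor.
exact: (dP (fun i => if i is 0 then g env else h env)).
Qed.

Lemma comp_succ k f : computable k f -> computable k (fun env => (f env).+1).
Proof. by apply: (comp_app1 (f := succn)); exists rSucc => env; constructor. Qed.

Lemma comp_const k c : computable k (fun=> c).
Proof. by elim: c => [|c /comp_succ //]; exists rZero => env; constructor. Qed.

(** The step reads the counter as variable 0 and the accumulator as variable 1, with the environment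
    shifted by two: the argument order of [rPrec]. *)
Lemma comp_rec k b s m : computable k b ->
  computable k.+2 (fun env => s (env 0) (env 1) (fun j => env j.+2)) -> computable k m ->
  computable k (fun env => iteri (m env) (fun i y => s i y env) (b env)).
Proof.
move=> [db dbP] [ds dsP] [dm dmP].
exists (rComp (rPrec db ds) (dm :: [seq rProj i | i <- iota 0 k])) => env.
apply: (ev_comp (ws := m env :: mkseq env k)).
  by constructor=> //; have := evals_projs env (leqnn k); rewrite subnn.
elim: (m env) => [|i IHi] /=; first by constructor.
apply: ev_precS; first exact: IHi.
set y := iteri _ _ _.
by have := dsP (push i (push y env)); rewrite !mkseq_push.
Qed.

Lemma comp_add k f g : computable k f -> computable k g -> computable k (fun env => f env + g env).
Proof.
apply: (comp_app2 (f := addn)).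
apply: (comp_ext (comp_rec (s := fun _ y _ => y.+1) (comp_var (i := 1) _)
  (comp_succ (comp_var (i := 1) _)) (comp_var (i := 0) _))) => // env.
by elim: (env 0) => //= m <-.
Qed.

Lemma comp_mul k f g : computable k f -> computable k g -> computable k (fun env => f env * g env).
Proof.
apply: (comp_app2 (f := muln)).
apply: (comp_ext (comp_rec (s := fun _ y env => env 1 + y) (comp_const _ 0)
  (comp_add (comp_var (i := 3) _) (comp_var (i := 1) _)) (comp_var (i := 0) _))) => // env.
by elim: (env 0) => //= m <-.
Qed.

Lemma comp_exp k f g : computable k f -> computable k g -> computable k (fun env => f env ^ g env).
Proof.
apply: (comp_app2 (f := expn)).
apply: (comp_ext (comp_rec (s := fun _ y env => env 0 * y) (comp_const _ 1)
  (comp_mul (comp_var (i := 2) _) (comp_var (i := 1) _)) (comp_var (i := 1) _))) => // env.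
by elim: (env 1) => //= m <-; rewrite expnS.
Qed.

Lemma comp_pred k f : computable k f -> computable k (fun env => (f env).-1).
Proof.
apply: (comp_app1 (f := predn)).
apply: (comp_ext (comp_rec (s := fun i _ _ => i) (comp_const _ 0)
  (comp_var (i := 0) _) (comp_var (i := 0) _))) => // env.
by case: (env 0).
Qed.

Lemma comp_sub k f g : computable k f -> computable k g -> computable k (fun env => f env - g env).
Proof.
apply: (comp_app2 (f := subn)).
apply: (comp_ext (comp_rec (s := fun _ y _ => y.-1) (comp_var (i := 0) _)
  (comp_pred (comp_var (i := 1) _)) (comp_var (i := 1) _))) => // env.
by elim: (env 1) => [|m IHm] /=; rewrite ?subn0 // -IHm subnS.
Qed.

Lemma dec_ext k P Q : dec k Q -> (forall env, P env <-> Q env) -> dec k P.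
Proof. by move=> [b cb bP] PQ; exists b => // env; rewrite PQ. Qed.

Lemma dec_lt k f g : computable k f -> computable k g -> dec k (fun env => f env < g env).
Proof.
move=> cf cg; exists (fun env => f env < g env) => //.
(* With truncated subtraction, [(f env).+1 - g env] vanishes iff [f env < g env], and [1 - m] tests
   [m] for zero. *)
apply: (comp_ext (comp_sub (comp_const _ 1) (comp_sub (comp_succ cf) cg))) => env.
by rewrite -subn_eq0; case: (_ - _).
Qed.

Lemma dec_not k P : dec k P -> dec k (fun env => ~ P env).
Proof.
move=> [b cb bP]; exists (fun env => ~~ b env).
  by apply: (comp_ext (comp_sub (comp_const _ 1) cb)) => env; case: (b env).
by move=> env; rewrite bP; split=> /negP.
Qed.

Lemma dec_and k P Q : dec k P -> dec k Q -> dec k (fun env => P env /\ Q env).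
Proof.
move=> [b cb bP] [c cc cP]; exists (fun env => b env && c env).
  by apply: (comp_ext (comp_mul cb cc)) => env; rewrite mulnb.
by move=> env; rewrite bP cP; split=> /andP.
Qed.

Lemma dec_imp k P Q : dec k P -> dec k Q -> dec k (fun env => P env -> Q env).
Proof.
move=> dP dQ; apply: (dec_ext (dec_not (dec_and dP (dec_not dQ)))) => env.
by split=> [PQ [/PQ]//|nPQ p]; apply: NNPP => q; apply: nPQ.
Qed.

Lemma dec_or k P Q : dec k P -> dec k Q -> dec k (fun env => P env \/ Q env).
Proof.
move=> dP dQ; apply: (dec_ext (dec_imp (dec_not dP) dQ)) => env.
by split=> [[]//|PQ]; case: (classic (P env)) => [|/PQ]; [left | right].
Qed.

Lemma dec_eq k f g : computable k f -> computable k g -> dec k (fun env => f env = g env).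
Proof.
move=> cf cg.
apply: (dec_ext (dec_not (dec_or (dec_lt cf cg) (dec_lt cg cf)))) => env.
split=> [-> []|ltP]; first by rewrite ltnn. by rewrite ltnn.
by case: (ltngtP (f env) (g env)) ltP => // lt_fg []; [left | right].
Qed.

(** Bounded search as bounded summation: the truth values of [P] are added up by primitive
    recursion, and the sum is positive iff there is a witness. *)
Lemma dec_exb k b P : computable k b ->
  dec k.+1 (fun env => P (env 0) (fun j => env j.+1)) ->
  dec k (fun env => exb (b env) (fun i => P i env)).
Proof.
move=> cb [c [d dP] cP].
pose g i env : nat := c (push i env).
exists (fun env => 0 < iteri (b env) (fun i y => g i env + y) 0).
  suff cr : computable k (fun env => iteri (b env) (fun i y => g i env + y) 0).
    by apply: (comp_ext (comp_sub (comp_const _ 1) (comp_sub (comp_const _ 1) cr))) => env;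
      case: (iteri _ _ _) => [|[]].
  apply: (comp_rec (s := fun i y env => g i env + y)) => //; first exact: comp_const.
  apply: comp_add; last exact: comp_var.
  (* The characteristic function takes the index and the environment; position 1 holds the
     accumulator and is skipped. *)
  exists (rComp d (rProj 0 :: [seq rProj i | i <- iota 2 k])) => env.
  apply: (ev_comp (ws := env 0 :: mkseq (fun j => env j.+2) k)).
    constructor; first exact: ev_proj.
    have := @evals_projs env k.+2 k (leq_trans (leqnSn _) (leqnSn _)).
    rewrite -addn2 addKn.
    by rewrite /mkseq (iotaDl 2 0) -[in X in _ -> X]map_comp -!map_comp.
  by have := dP (push (env 0) (fun j => env j.+2)); rewrite mkseq_push.
move=> env; rewrite /exb; elim: (b env) => [|m IHm] /=; first by split=> // -[].
rewrite addn_gt0 lt0b; split.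
  move=> [i]; rewrite ltnS leq_eqVlt => /orP[/eqP-> /(cP (push m env))->//|im Pi].
  by apply/orP; right; apply/IHm; exists i.
by case/orP=> [/(cP (push m env))|/IHm[i im Pi]]; [exists m | exists i => //; apply: ltnW].
Qed.

Lemma dec_allb k b P : computable k b ->
  dec k.+1 (fun env => P (env 0) (fun j => env j.+1)) ->
  dec k (fun env => allb (b env) (fun i => P i env)).
Proof.
move=> cb dP; have dnP := dec_not dP.
apply: (dec_ext (dec_not (dec_exb (P := fun i env => ~ P i env) cb dnP))) => env.
split=> [aP [i /aP Pi /(_ Pi)]//|nP i ib]; apply: NNPP => nPi.
by apply: nP; exists i.
Qed.

(** Minimisation looks for a zero, so it is applied to the characteristic function of the complement
    of the graph, whose only zero is the value of [f]. *)
Lemma comp_graph k f : dec k.+1 (fun env => env 0 = f (fun j => env j.+1)) ->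
  computable k f.
Proof.
move=> /dec_not[b [d dP] bP]; exists (rMu d) => env.
have Ed i : eval d (i :: mkseq env k) (b (push i env)).
  by have := dP (push i env); rewrite mkseq_push.
constructor.
  have := Ed (f env); case Eb : (b _) => //.
  by have /bP[] : b (push (f env) env) by rewrite Eb.
move=> m mf; exists 0; have := Ed m.
case Eb : (b _) => //.
have [//|] := classic (b (push m env)); first by rewrite Eb.
by move/bP=> [] /= e; rewrite e ltnn in mf.
Qed.

Lemma comp_div k f g : computable k f -> computable k g -> computable k (fun env => f env %/ g env).
Proof.
apply: (comp_app2 (f := divn)); apply: comp_graph.
have c i : i < 3 -> computable 3 (fun env => env i) by apply: comp_var.
(* The first disjunct is the convention that a quotient by 0 is 0; for divisor 0 the second disjunct
   is false. *)
apply: (dec_ext (dec_or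
  (dec_and (dec_eq (c 2 _) (comp_const _ 0)) (dec_eq (c 0 _) (comp_const _ 0)))
  (dec_and (dec_lt (comp_mul (c 0 _) (c 2 _)) (comp_succ (c 1 _)))
           (dec_lt (c 1 _) (comp_mul (comp_succ (c 0 _)) (c 2 _)))))) => // env.
case: (posnP (env 2)) => [->|b_gt0].
  rewrite divn0 !muln0; split=> [->|]; [by left | by case=> [[_]|[]]].
rewrite ltnS -leq_divRL // -ltn_divLR // ltnS; split=> [->|]; first by right.
by case=> [[e _]|[le1 le2]]; [rewrite e in b_gt0 | apply/eqP; rewrite eqn_leq le1].
Qed.

Lemma comp_mod k f g : computable k f -> computable k g -> computable k (fun env => f env %% g env).
Proof.
move=> cf cg; apply: (comp_ext (comp_sub cf (comp_mul (comp_div cf cg) cg))) => env.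
by rewrite {2}(divn_eq (f env) (g env)) addKn.
Qed.

Lemma cpairE a b : cpair a b = ((a + b) * (a + b + 1)) %/ 2 + b.
Proof.
rewrite /cpair addn1; congr (_ + _).
(* The numerator is twice a binomial coefficient, so [Nat.div] and [%/] both divide exactly. *)
have -> : (a + b) * (a + b).+1 = 'C((a + b).+1, 2) * 2.
  by rewrite bin2 /= muln2 -[LHS]odd_double_half mulnC oddM /= andNb.
rewrite mulnK //; exact: PeanoNat.Nat.div_mul.
Qed.

Lemma comp_cpair k f g : computable k f -> computable k g ->
  computable k (fun env => cpair (f env) (g env)).
Proof.
move=> cf cg; have cfg := comp_add cf cg.
apply: (comp_ext (comp_add (comp_div (comp_mul cfg (comp_add cfg (comp_const _ 1)))
  (comp_const _ 2)) cg)) => env; exact: cpairE.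
Qed.
(** * From saturated sets of types to simplicial models *)

(** [pos] and [neg] are independent relations: a type may leave a formula undecided, as happens for
    formulas with large codes. *)
Record hintikka (n : nat) := Hintikka {
  state : Type;
  alive : state -> 'I_n -> Prop;
  atom : state -> nat -> 'I_n -> Prop;
  pos : state -> (nat -> 'I_n) -> form n -> Prop;
  neg : state -> (nat -> 'I_n) -> form n -> Prop
}.

(** For empty [X] the premise of the last clause is vacuous, so facts about the empty group are the
    same at both ends of every edge. *)
Definition agree n (H : hintikka n) (B : seq 'I_n) (t u : state H) : Prop :=
  [/\ forall a, a \in B -> alive t a /\ alive u a,
      forall p a, a \in B -> atom t p a <-> atom u p a
    & forall s X phi, (forall x, x \in X -> s x \in B) ->
        pos t s (fK X phi) <-> pos u s (fK X phi)].

Definition edge n (H : hintikka n) (B : seq 'I_n) (t u : state H) : Prop :=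
  [/\ exists2 a, alive t a & a \notin B, exists2 a, alive u a & a \notin B
    & agree B t u].

Definition all_alive n (H : hintikka n) (t : state H) (s : nat -> 'I_n) (X : seq nat) :=
  forall x, x \in X -> alive t (s x).

(** The condition on asserted knowledge is local to [t]. Its effect on other facets comes from
    [agree], which carries the asserted formula along the edges. *)
Record saturated n (H : hintikka n) (T : state H -> Prop) : Prop := {
  sat_alive t : T t -> exists a, alive t a;
  sat_pos_pred t s p x : T t -> pos t s (fPred n p x) ->
    alive t (s x) /\ atom t p (s x);
  sat_neg_pred t s p x : T t -> neg t s (fPred n p x) -> alive t (s x) ->
    ~ atom t p (s x);
  sat_neg_top t s : T t -> ~ neg t s fTop;
  sat_pos_neg t s f : T t -> pos t s (fNeg f) -> neg t s f;
  sat_neg_neg t s f : T t -> neg t s (fNeg f) -> pos t s f;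
  sat_pos_and t s f g : T t -> pos t s (fAnd f g) -> pos t s f /\ pos t s g;
  sat_neg_and t s f g : T t -> neg t s (fAnd f g) -> neg t s f \/ neg t s g;
  sat_pos_assign t s x a f : T t -> pos t s (fAssign x a f) -> alive t a ->
    pos t (upd s x a) f;
  sat_neg_assign t s x a f : T t -> neg t s (fAssign x a f) ->
    alive t a /\ neg t (upd s x a) f;
  sat_pos_K t s X f : T t -> pos t s (fK X f) -> all_alive t s X -> pos t s f;
  sat_neg_K t s X f : T t -> neg t s (fK X f) -> all_alive t s X /\
    (neg t s f \/ exists u B, [/\ T u, neg u s f,
                                 forall x, x \in X -> s x \in B & edge B t u])
}.

Section Tree.

Variables (n : nat) (H : hintikka n) (T : state H -> Prop) (root : state H).

Definition world : Type := seq (seq 'I_n * state H).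

Definition last_type (w : world) : state H := if w is (_, t) :: _ then t else root.

Fixpoint path_ok (w : world) : Prop :=
  if w is (B, t) :: w' then [/\ T t, edge B (last_type w') t & path_ok w']
  else T root.

(* [strip q w] is the last world on the way from [w] to the root that is
   reached through edges whose labels all satisfy [q]. It serves as canonical
   representative of the class of [w] for the relation of being joined
   by a path with labels in [q]. *)
Fixpoint strip (q : pred (seq 'I_n)) (w : world) : world :=
  if w is (B, _) :: w' then (if q B then strip q w' else w) else [::].

Definition rep (a : 'I_n) := strip (fun B => a \in B).

Definition rep_all (s : nat -> 'I_n) (X : seq nat) :=
  strip (fun B => all (fun x => s x \in B) X).

Lemma strip_suffix q w : exists w', w = w' ++ strip q w.
Proof.
elim: w => [|[B t] w [w' IHw]] /=; first by exists [::].
case: (q B); last by exists [::].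
by exists ((B, t) :: w'); rewrite /= -IHw.
Qed.

Lemma path_okT w : path_ok w -> T (last_type w).
Proof. by case: w => [|[B t] w] //= []. Qed.

Lemma strip_invariant (q : pred (seq 'I_n)) (P : state H -> Prop) w :
  (forall B t u, q B -> edge B t u -> P t <-> P u) -> path_ok w ->
  P (last_type (strip q w)) <-> P (last_type w).
Proof.
move=> Pedge; elim: w => [|[B t] w IHw] //= [_ e ok].
by case: ifP => // /Pedge/(_ e)<-; apply: IHw.
Qed.

Lemma rep_val a p w : path_ok w ->
  atom (last_type (rep a w)) p a <-> atom (last_type w) p a.
Proof.
apply: (strip_invariant (P := fun t => atom t p a)) => B t u aB [_ _ [_ vl _]].
exact: vl.
Qed.

Lemma rep_all_pos s X f w : path_ok w ->
  pos (last_type (rep_all s X w)) s (fK X f) <-> pos (last_type w) s (fK X f).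
Proof.
apply: (strip_invariant (P := fun t => pos t s (fK X f))) => B t u.
by move=> /allP sXB [_ _ [_ _ /(_ s X f sXB)]].
Qed.

(** The walk to the root for the group stops at the first label that misses some [s x], and the walk
    for that single agent stops at the same place. *)
Lemma rep_all_rep s X w : X <> [::] ->
  exists2 x, x \in X & rep_all s X w = rep (s x) w.
Proof.
move=> X_neq0; have [x0 x0X] : exists x0, x0 \in X.
  by case: X X_neq0 => // x0 X _; exists x0; apply: mem_head.
elim: w => [|[B t] w [x xX IHw]]; first by exists x0.
rewrite /rep_all [strip _ _]/= -/(rep_all s X w).
case: allP => [sXB|nsXB].
  by exists x; rewrite // /rep /= (sXB x xX).
have [y yX syB] : exists2 y, y \in X & s y \notin B.
  apply: NNPP => nex; apply: nsXB => y yX; apply: contraT => syB.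
  by case: nex; exists y.
by exists y; rewrite // /rep /= (negPf syB).
Qed.

Lemma size_strip (q q' : pred (seq 'I_n)) w : subpred q' q ->
  size (strip q w) <= size (strip q' w).
Proof.
move=> q'q; elim: w => [|[B t] w IHw] //=.
case: (boolP (q' B)) => [/q'q-> //|_]; case: (q B) => //=.
by case: (strip_suffix q w) => w' /(congr1 size);
  rewrite size_cat /= => ->; apply: leqW; apply: leq_addl.
Qed.

Lemma cat_sizer (A : Type) (a b c d : seq A) : a ++ b = c ++ d ->
  size b = size d -> b = d.
Proof.
move=> e sbd; have sac : size a = size c.
  by move/(congr1 size): e; rewrite !size_cat sbd => /addIn.
by move/(congr1 (drop (size a))): e; rewrite {2}sac !drop_size_cat.
Qed.

(** Because worlds form a tree, sharing a vertex for each agent of a group yields one joining path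
    whose labels contain the whole group. The group representative is the longest of the individual
    ones, attained by some [x] at [w] and some [y] at [u]. Comparing the two lengths through the
    assumed equalities shows that they are equal, and suffixes of [u] of equal length coincide. *)
Lemma rep_all_eq s X w u : (forall x, x \in X -> rep (s x) w = rep (s x) u) ->
  rep_all s X w = rep_all s X u.
Proof.
have rep0 v : rep_all s [::] v = [::] by elim: v => [|[B t] v].
have [->|/eqP X_neq0 reps] := eqVneq X [::]; first by rewrite !rep0.
have size_le x v : x \in X -> size (rep (s x) v) <= size (rep_all s X v).
  by move=> xX; apply: size_strip => B /allP; apply.
have [x xX xw] := rep_all_rep s w X_neq0.
have [y yX yu] := rep_all_rep s u X_neq0.
have [u1 eu1] := strip_suffix (fun B => s x \in B) u.
have [u2 eu2] := strip_suffix (fun B => s y \in B) u.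
rewrite xw yu reps //; apply: (@cat_sizer _ u1 _ u2); first by rewrite -eu1 -eu2.
apply/eqP; rewrite eqn_leq -{2}(reps x xX) -{1}yu size_le //=.
by rewrite -xw -reps // size_le.
Qed.

(** The last label of [w] misses an agent alive there, whose representative is [w] itself; hence [w]
    is a suffix of [v]. If [v] were longer, the first label beyond [w] would miss an agent alive at
    [w], whose representative at [v] would be longer than [w], yet it equals the one at [w]. *)
Lemma rep_inj w v : path_ok w -> path_ok v ->
  (forall a, alive (last_type w) a -> rep a w = rep a v) -> w = v.
Proof.
move=> okw okv reps.
have [p def_v] : exists p, v = p ++ w.
  case: w okw reps => [|[B t] w]; first by exists v; rewrite cats0.
  move=> [_ [_ [a al naB] _] _] /(_ a al); rewrite {1}/rep /= (negPf naB) => ->.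
  exact: strip_suffix.
case: (lastP p) def_v => [->//|q [B t]]; rewrite cat_rcons => def_v.
suff : size w < size w by rewrite ltnn.
have [_ [[a al naB] _ _] _] : path_ok ((B, t) :: w).
  by elim: q {reps} v okv def_v => [|[B' t'] q IHq] v okv def_v; subst v;
    last by case: okv => _ _ /IHq; apply.
have [w' /(congr1 size)] := strip_suffix (fun B => a \in B) w.
rewrite size_cat -/(rep a w) reps // => size_w.
rewrite {2}size_w; apply: leq_trans (leq_addl _ _).
rewrite def_v; elim: q {def_v okv reps} => [|[B' t'] q IHq] /=.
  by rewrite /rep /= (negPf naB).
rewrite /rep /=; case: ifP => // _ /=.
by rewrite size_cat /= ltnS (leq_trans _ (leq_addl _ _)).
Qed.

Hypotheses (satT : saturated T) (Troot : T root).

(** Canonical representatives take the place of a quotient of the pairs of a colour and a world. *)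
Definition vertex : Type :=
  {v : 'I_n * world | exists w, [/\ path_ok w, alive (last_type w) v.1 & v.2 = rep v.1 w]}.

Definition facet_of (w : world) (v : vertex) : Prop :=
  alive (last_type w) (sval v).1 /\ (sval v).2 = rep (sval v).1 w.

Lemma facet_ofP w a : path_ok w -> alive (last_type w) a ->
  exists v, facet_of w v /\ sval v = (a, rep a w).
Proof.
move=> okw al.
have ex : exists w0, [/\ path_ok w0, alive (last_type w0) (a, rep a w).1
                       & (a, rep a w).2 = rep (a, rep a w).1 w0] by exists w.
by exists (exist _ (a, rep a w) ex).
Qed.

Definition tree_simp (s : vertex -> Prop) : Prop :=
  (exists v, s v) /\ exists2 w, path_ok w & forall v, s v -> facet_of w v.

Lemma vertex_inj (u v : vertex) : sval u = sval v -> u = v.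
Proof.
case: u v => [u pu] [v pv] /= e; subst v.
by rewrite (proof_irrelevance _ pu pv).
Qed.

Lemma tree_inhabited : inhabited vertex.
Proof.
have [a al] := sat_alive satT Troot.
by have [v _] := @facet_ofP [::] a Troot al; exact: (inhabits v).
Qed.

Lemma tree_simp_down s t : tree_simp s -> (forall v, t v -> s v) ->
  (exists v, t v) -> tree_simp t.
Proof. by move=> [_ [w okw sw]] ts t0; split=> //; exists w => // v /ts/sw. Qed.

Lemma tree_simp_single v : tree_simp (fun u => u = v).
Proof.
split; first by exists v.
by case: (svalP v) => w [okw al e]; exists w => // _ ->.
Qed.

Lemma tree_chi_inj s : tree_simp s -> forall u v, s u -> s v ->
  (sval u).1 = (sval v).1 -> u = v.
Proof.
move=> [_ [w _ sw]] u v /sw[_ eu] /sw[_ ev] e; apply: vertex_inj.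
by rewrite [LHS]surjective_pairing [RHS]surjective_pairing eu ev e.
Qed.

(** Atoms are read off at the representative; by [rep_val] every world having the vertex gives the
    same answer. *)
Definition tree_model : simplicial_model n :=
  @SModel n vertex tree_simp (fun v => (sval v).1)
    (fun p v => atom (last_type (sval v).2) p (sval v).1) tree_inhabited
    (fun s ss => proj1 ss) tree_simp_down tree_simp_single tree_chi_inj.

Lemma facet_of_simp w : path_ok w -> tree_simp (facet_of w).
Proof.
move=> okw; split; last by exists w.
have [a al] := sat_alive satT (path_okT okw).
by have [v []] := facet_ofP okw al; exists v.
Qed.

Lemma facet_of_facet w : path_ok w -> @facet n tree_model (facet_of w).
Proof.
move=> okw; split; first exact: facet_of_simp.
move=> G [_ [u oku Gu]] wG v Gv; suff -> : w = u by apply: Gu.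
apply: rep_inj => // a al; have [x [xw ex]] := facet_ofP okw al.
by have [_] := Gu _ (wG _ xw); rewrite ex.
Qed.

Lemma facetE G : @facet n tree_model G -> exists2 w, path_ok w & G = facet_of w.
Proof.
move=> [[G0 [w okw Gw]] maxG]; exists w => //.
apply: functional_extensionality => v; apply: propositional_extensionality.
by split=> [/Gw//|]; apply: maxG => //; apply: facet_of_simp.
Qed.

Lemma tree_truth phi s w : path_ok w ->
  (pos (last_type w) s phi -> sat (M := tree_model) (facet_of w) s phi) /\
  (neg (last_type w) s phi -> ~ sat (M := tree_model) (facet_of w) s phi).
Proof.
elim: phi s w => [p x||f IHf|f IHf g IHg|x a f IHf|X f IHf] s w okw;
  have Tw := path_okT okw; split=> /=.
- case/(sat_pos_pred satT Tw) => al vl; have [v [wv ev]] := facet_ofP okw al.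
  by exists v; rewrite ev; do 2!split=> //; apply/rep_val.
- move=> /(sat_neg_pred satT Tw) nvl [v [[al ev] [vl e]]].
  by apply: nvl; rewrite -e // -rep_val // -ev.
- by [].
- by move/(sat_neg_top satT Tw).
- by move/(sat_pos_neg satT Tw)/(proj2 (IHf _ _ okw)).
- by move=> /(sat_neg_neg satT Tw)/(proj1 (IHf _ _ okw)) sf nsf.
- by move=> /(sat_pos_and satT Tw)[/(proj1 (IHf _ _ okw))? /(proj1 (IHg _ _ okw))].
- move=> /(sat_neg_and satT Tw) fg [sf sg].
  by case: fg => [/(proj2 (IHf _ _ okw))|/(proj2 (IHg _ _ okw))].
- move=> pf [v [[al _] e]]; apply: (proj1 (IHf _ _ okw)).
  by apply: (sat_pos_assign satT Tw pf); rewrite -e.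
- move=> /(sat_neg_assign satT Tw)[al nf] sf; apply: (proj2 (IHf _ _ okw) nf).
  by apply: sf; have [v [wv ev]] := facet_ofP okw al; exists v; rewrite ev.
(* The asserted knowledge passes from [w] to the common group representative and from there to [u],
   where the local condition applies. *)
- move=> pK _ /facetE[u oku ->] sh; apply: (proj1 (IHf _ _ oku)).
  apply: (sat_pos_K satT (path_okT oku) (X := X)).
    have reps : rep_all s X w = rep_all s X u.
      by apply: rep_all_eq => x /sh[v [[_ ew] [[_ eu] <-]]]; rewrite -ew -eu.
    by rewrite -rep_all_pos // -reps rep_all_pos.
  by move=> x /sh[v [_ [[al _] <-]]].
- case/(sat_neg_K satT Tw) => al [nf|[t [B [Tt nf sXB e]]]] sK.
    apply: (proj2 (IHf _ _ okw) nf); apply: sK; first exact: facet_of_facet.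
    move=> x /al alx; have [v [wv ev]] := facet_ofP okw alx.
    by exists v; rewrite ev.
  (* The refuting type becomes a new child of [w]; agents in [B] have the same representative at
     both worlds. *)
  have oku : path_ok ((B, t) :: w) by [].
  apply: (proj2 (IHf _ _ oku) nf); apply: sK; first exact: facet_of_facet.
  move=> x xX; have [v [wv ev]] := facet_ofP okw (al _ xX).
  exists v; rewrite ev; split=> //; split=> //; rewrite /facet_of ev /=.
  have [_ _ [al2 _ _]] := e; have [_ alt] := al2 _ (sXB _ xX).
  by split; rewrite // /rep /= sXB.
Qed.

End Tree.

Theorem saturated_satisfiable n (H : hintikka n) (T : state H -> Prop) t alpha :
  saturated T -> T t -> (forall s, pos t s alpha) -> satisfiable alpha.
Proof.
move=> satT Tt pt; exists (tree_model satT Tt), (@facet_of _ _ T t [::]).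
split; first exact: facet_of_facet.
by move=> s; apply: (proj1 (tree_truth satT Tt alpha s (w := [::]) Tt)).
Qed.
(** * Arithmetical codes of types *)

(** Pairs with sum [s] are coded within [s] of the triangular number of [s], so different diagonals
    get disjoint intervals of codes. *)
Lemma tri_lt s s' : s < s' -> (s * (s + 1)) %/ 2 + s < (s' * (s' + 1)) %/ 2.
Proof.
move=> ss'; have tri m : (m * (m + 1)) %/ 2 = 'C(m.+1, 2).
  by rewrite bin2 /= addn1 divn2 mulnC.
rewrite !tri.
apply: (@leq_trans ('C(s.+2, 2))); first by rewrite (binS s.+1) bin1 addnS.
by apply: leq_bin2l; rewrite ltnS.
Qed.

Lemma cpair_inj a b a' b' : cpair a b = cpair a' b' -> a = a' /\ b = b'.
Proof.
rewrite !cpairE => e.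
have lt_s x y x' y' : x + y < x' + y' ->
  ((x + y) * (x + y + 1)) %/ 2 + y < ((x' + y') * (x' + y' + 1)) %/ 2 + y'.
  move=> /tri_lt lt1; apply: leq_trans (leq_addr _ _); apply: leq_trans lt1.
  by rewrite ltnS leq_add2l leq_addl.
case: (ltngtP (a + b) (a' + b')) => [/lt_s|/lt_s|es]; rewrite ?e ?ltnn //.
move: e; rewrite es => /addnI eb; split=> //.
by move: es; rewrite eb => /addIn.
Qed.

Lemma leq_cpair a b a' b' : a <= a' -> b <= b' -> cpair a b <= cpair a' b'.
Proof.
by move=> aa' bb'; rewrite !cpairE leq_add // leq_div2r // leq_mul ?leq_add.
Qed.

Lemma cpair_ge2 a b : b <= cpair a b.
Proof. by rewrite cpairE leq_addl. Qed.

Lemma cpair_ge1 a b : a <= cpair a b.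
Proof.
apply: leq_trans (leq_cpair (leqnn a) (leq0n b)).
rewrite cpairE !addn0 leq_divRL //.
by case: a => // a; rewrite leq_mul2l addn1.
Qed.

Lemma cpair_lt a b N : cpair a b < N -> a < N /\ b < N.
Proof.
by move=> lt_N; split; apply: leq_ltn_trans lt_N; [apply: cpair_ge1 | apply: cpair_ge2].
Qed.

Definition digit (b e x : nat) : nat := e %/ b ^ x %% b.

Definition bit (t i : nat) : bool := digit 2 t i == 1.

(** Finite choice in arithmetical form: base 2 yields sets, base [n] yields assignments. *)
Lemma digits_exist b N (R : nat -> nat -> Prop) :
  (forall x, exists2 y, y < b & R x y) ->
  exists2 e, e < b ^ N & forall x, x < N -> R x (digit b e x).
Proof.
elim: N R => [|N IHN] R Rtot; first by exists 0.
have [e lt_e eR] := IHN (fun x => R x.+1) (fun x => Rtot x.+1).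
have [y yb Ry] := Rtot 0; have b_gt0 : 0 < b by apply: leq_ltn_trans yb.
exists (e * b + y) => [|[|x] xN].
- rewrite expnSr; apply: (@leq_trans (e.+1 * b)); last by rewrite leq_mul2r lt_e orbT.
  by rewrite mulSn addnC ltn_add2r.
- by rewrite /digit expn0 divn1 modnMDl modn_small.
- by rewrite /digit expnS divnMA divnMDl // (divn_small yb) addn0; apply: eR.
Qed.

Lemma digit_big b e x N : 0 < b -> e < b ^ N -> N <= x -> digit b e x = 0.
Proof.
move=> b_gt0 lt_e Nx; rewrite /digit divn_small ?mod0n //.
by apply: leq_trans lt_e _; apply: leq_pexp2l.
Qed.

Lemma bits_exist N (P : nat -> Prop) :
  exists2 t, t < 2 ^ N & forall i, i < N -> bit t i <-> P i.
Proof.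
apply: (@digits_exist 2 N (fun i y => (y == 1) <-> P i)) => i.
by case: (classic (P i)) => Pi; [exists 1 | exists 0].
Qed.

Lemma bit_lt t i N : t < 2 ^ N -> bit t i -> i < N.
Proof.
by move=> tN; rewrite ltnNge; apply: contraL => Ni; rewrite /bit (digit_big _ tN).
Qed.

(* [x] occurs in the list coded by [X], for [X < N]; this is said without
   recursion on codes: each set of codes that contains [X] and is closed under taking
   tails contains a list with head [x]. *)
Definition mem_code (N x X : nat) : Prop :=
  allb (2 ^ N) (fun M => bit M X ->
    allb N (fun y => allb N (fun d => bit M (cpair y d).+1 -> bit M d)) ->
    exb N (fun d => bit M (cpair x d).+1)).

Lemma mem_enc_list x X : x \in X -> x < enc_list X.
Proof.
elim: X => //= y X IHX; rewrite inE ltnS => /orP[/eqP->|/IHX lt_x].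
  exact: cpair_ge1.
by apply: leq_trans (ltnW lt_x) (cpair_ge2 _ _).
Qed.

Lemma enc_list_succ X y d : enc_list X = (cpair y d).+1 ->
  exists2 X', X = y :: X' & d = enc_list X'.
Proof. by case: X => //= z X [/cpair_inj[-> <-]]; exists X. Qed.

Lemma mem_codeP N x X : enc_list X < N -> mem_code N x (enc_list X) <-> x \in X.
Proof.
move=> XN; split=> [memx|xX M _].
  (* The test set consists of the codes of the suffixes of [X]; a suffix with head [x] puts [x] in
     [X]. *)
  have [M lt_M MP] := bits_exist N (fun j => exists Y Z, X = Y ++ Z /\ j = enc_list Z).
  have [] := memx M lt_M.
  - by apply/MP => //; exists [::], X.
  - move=> y _ d dN /[dup] /(bit_lt lt_M)/MP bitP /bitP[Y [Z [eX /esym/enc_list_succ[Z' eZ ed]]]].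
    by apply/MP => //; exists (rcons Y y), Z'; rewrite cat_rcons -eZ.
  - move=> d _ /[dup] /(bit_lt lt_M)/MP bitP /bitP[Y [Z [-> /esym/enc_list_succ[Z' -> _]]]].
    by rewrite mem_cat mem_head orbT.
elim: X XN xX => //= y X IHX => /ltnW/cpair_lt[yN XN].
rewrite inE => /orP[/eqP->|/(IHX XN) xX] MX tailM; first by exists (enc_list X).
by apply: xX => //; apply: tailM MX.
Qed.

Section Code.

Variables n N : nat.

(* A type is the number whose binary digits record which agents are alive,
   which local atoms hold, and which formulas are asserted or refuted under
   which assignments; [e < n ^ N] codes the assignment of its base [n] digits
   to the variables below [N]. *)
Definition alive_bit (t a : nat) : bool := bit t (cpair 0 a).
Definition val_bit (t p a : nat) : bool := bit t (cpair 1 (cpair p a)).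
Definition pos_bit (t e f : nat) : bool := bit t (cpair 2 (cpair e f)).
Definition neg_bit (t e f : nat) : bool := bit t (cpair 3 (cpair e f)).

(** A strict bound on all entries of a type: 3 is the largest tag, and the sum dominates agents,
    codes below [N] and assignments. *)
Definition nbits : nat :=
  (cpair 3 (cpair (n + N + n ^ N) (n + N + n ^ N))).+1.

Definition for_vars (e X : nat) (Q : nat -> Prop) : Prop :=
  allb N (fun x => mem_code N x X -> Q (digit n e x)).

Definition agree_code (B t u : nat) : Prop :=
  allb n (fun a => bit B a -> alive_bit t a /\ alive_bit u a) /\
  allb N (fun p => allb n (fun a => bit B a -> (val_bit t p a <-> val_bit u p a))) /\
  allb (n ^ N) (fun e => allb N (fun X => allb N (fun f =>
    for_vars e X (fun a => bit B a) ->
    (pos_bit t e (cpair 5 (cpair X f)) <-> pos_bit u e (cpair 5 (cpair X f)))))).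

Definition edge_code (B t u : nat) : Prop :=
  exb n (fun a => alive_bit t a /\ ~ bit B a) /\
  exb n (fun a => alive_bit u a /\ ~ bit B a) /\ agree_code B t u.

Definition upd_code (e e' x a : nat) : Prop :=
  allb N (fun y => (y = x /\ digit n e' y = a) \/
                   (y <> x /\ digit n e' y = digit n e y)).

(** The tags 0 to 5 inside formula codes are those of [enc]. Components range over all numbers below
    [N], even those that code nothing; the type of a facet passes these instances because its bits
    mention only codes of formulas. *)
Definition saturated_code (T t : nat) : Prop :=
  exb n (fun a => alive_bit t a) /\
  allb (n ^ N) (fun e =>
    ~ neg_bit t e (cpair 1 0) /\
    allb N (fun p => allb N (fun x =>
      (pos_bit t e (cpair 0 (cpair p x)) ->
        alive_bit t (digit n e x) /\ val_bit t p (digit n e x)) /\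
      (neg_bit t e (cpair 0 (cpair p x)) -> alive_bit t (digit n e x) ->
        ~ val_bit t p (digit n e x)))) /\
    allb N (fun f =>
      (pos_bit t e (cpair 2 f) -> neg_bit t e f) /\
      (neg_bit t e (cpair 2 f) -> pos_bit t e f) /\
      allb N (fun g =>
        (pos_bit t e (cpair 3 (cpair f g)) -> pos_bit t e f /\ pos_bit t e g) /\
        (neg_bit t e (cpair 3 (cpair f g)) -> neg_bit t e f \/ neg_bit t e g)) /\
      allb N (fun x => allb n (fun a => allb (n ^ N) (fun e' =>
        upd_code e e' x a ->
        (pos_bit t e (cpair 4 (cpair x (cpair a f))) -> alive_bit t a ->
          pos_bit t e' f) /\
        (neg_bit t e (cpair 4 (cpair x (cpair a f))) ->
          alive_bit t a /\ neg_bit t e' f)))) /\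
      allb N (fun X =>
        (pos_bit t e (cpair 5 (cpair X f)) ->
          for_vars e X (fun a => alive_bit t a) -> pos_bit t e f) /\
        (neg_bit t e (cpair 5 (cpair X f)) ->
          for_vars e X (fun a => alive_bit t a) /\
          (neg_bit t e f \/
           exb (2 ^ nbits) (fun u => bit T u /\ neg_bit u e f /\
             exb (2 ^ n) (fun B =>
               for_vars e X (fun a => bit B a) /\ edge_code B t u))))))).

End Code.

(** The bound [c.+1] covers [c] and, as [cpair] dominates its arguments, the codes of all
    subformulas, variables and predicate letters in it. *)
Definition satisfiable_code (n c : nat) : Prop :=
  exb (2 ^ 2 ^ nbits n c.+1) (fun T =>
    exb (2 ^ nbits n c.+1) (fun t =>
      bit T t /\ allb (n ^ c.+1) (fun e => pos_bit t e c)) /\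
    allb (2 ^ nbits n c.+1) (fun t => bit T t -> saturated_code n c.+1 T t)).

(** * Decidability of coded satisfiability *)

Lemma comp_digit k b e x : computable k b -> computable k e -> computable k x ->
  computable k (fun env => digit (b env) (e env) (x env)).
Proof. by move=> cb ce cx; exact: comp_mod (comp_div ce (comp_exp cb cx)) cb. Qed.

Lemma dec_bit k t i : computable k t -> computable k i -> dec k (fun env => bit (t env) (i env)).
Proof.
move=> ct ci.
apply: (dec_ext (dec_eq (comp_digit (comp_const _ 2) ct ci) (comp_const _ 1))) => env.
by split=> /eqP.
Qed.

Lemma dec_iff k P Q : dec k P -> dec k Q -> dec k (fun env => P env <-> Q env).
Proof. by move=> dP dQ; apply: dec_and (dec_imp dP dQ) (dec_imp dQ dP). Qed.

Ltac solve_comp := solve [repeat first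
  [ exact: comp_var | exact: comp_const | apply: comp_cpair | apply: comp_digit
  | apply: comp_exp | apply: comp_add | apply: comp_succ ]].

Ltac solve_dec := repeat first
  [ apply: dec_bit; solve_comp | apply: dec_exb; [solve_comp|]
  | apply: dec_allb; [solve_comp|] | apply: dec_eq; solve_comp | apply: dec_iff
  | apply: dec_and | apply: dec_or | apply: dec_not | apply: dec_imp ].

Lemma satisfiable_code_dec n : dec 1 (fun env => satisfiable_code n (env 0)).
Proof.
rewrite /satisfiable_code /saturated_code /edge_code /agree_code /upd_code
  /for_vars /mem_code /alive_bit /val_bit /pos_bit /neg_bit /nbits.
solve_dec.
Qed.
(** * The types of the facets of a model *)

Section Decode.

Variables n N : nat.
Hypothesis n_gt0 : 0 < n.

Definition assignment (e x : nat) : 'I_n :=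
  Ordinal (ltn_pmod (e %/ n ^ x) n_gt0 : digit n e x < n).

Lemma assignment_exists (s : nat -> 'I_n) :
  exists2 e, e < n ^ N & forall x, x < N -> digit n e x = s x.
Proof.
apply: (@digits_exist n N (fun x y => y = s x)) => x.
by exists (s x).
Qed.

Lemma upd_codeP e e' x (a : 'I_n) : x < N -> e < n ^ N -> e' < n ^ N ->
  upd_code n N e e' x a <-> assignment e' = upd (assignment e) x a.
Proof.
move=> xN eE e'E; split=> [ue|ue y yN]; last first.
  have /(congr1 val) := congr1 (@^~ y) ue; rewrite /upd /=.
  by case: PeanoNat.Nat.eqb_spec => yx /= e'y; [left | right].
apply: functional_extensionality => y; apply: val_inj; rewrite /upd /=.
case: (ltnP y N) => [/ue|Ny].
  by case: PeanoNat.Nat.eqb_spec => yx [] [] //.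
(* At and beyond [N] both codes have only zero digits, and the updated variable lies below [N]. *)
case: PeanoNat.Nat.eqb_spec => [yx|_ /=]; first by rewrite yx leqNgt xN in Ny.
by rewrite !(digit_big n_gt0 _ Ny).
Qed.

Lemma nbits_bound k a b : k <= 3 -> a < n + N + n ^ N -> b < n + N + n ^ N ->
  cpair k (cpair a b) < nbits n N.
Proof. by move=> k3 /ltnW aK /ltnW bK; rewrite ltnS leq_cpair // leq_cpair. Qed.

Lemma nbits_bound0 a : a < n -> cpair 0 a < nbits n N.
Proof.
move=> an; rewrite ltnS leq_cpair //; apply: leq_trans (cpair_ge1 _ _).
by rewrite -addnA; apply: leq_trans (ltnW an) (leq_addr _ _).
Qed.

Lemma bound_agent a : a < n -> a < n + N + n ^ N.
Proof. by move=> an; rewrite -addnA ltn_addr. Qed.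

Lemma bound_code a : a < N -> a < n + N + n ^ N.
Proof. by move=> aN; rewrite ltn_addr // ltn_addl. Qed.

Lemma bound_assignment e : e < n ^ N -> e < n + N + n ^ N.
Proof. by move=> eE; rewrite ltn_addl. Qed.

Section Types.

Variable M : simplicial_model n.

Definition fact (F : vert M -> Prop) (j : nat) : Prop :=
  [\/ exists a : 'I_n, j = cpair 0 a /\ exists v, F v /\ chi v = a,
      exists p (a : 'I_n), j = cpair 1 (cpair p a) /\
        exists v, F v /\ lab p v /\ chi v = a,
      exists e phi, j = cpair 2 (cpair e (enc phi)) /\ sat F (assignment e) phi
    | exists e phi, j = cpair 3 (cpair e (enc phi)) /\ ~ sat F (assignment e) phi].

Definition describes (F : vert M -> Prop) (t : nat) : Prop :=
  t < 2 ^ nbits n N /\ forall j, j < nbits n N -> bit t j <-> fact F j.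

Lemma describes_exists F : exists t, describes F t.
Proof. by have [t] := bits_exist (nbits n N) (fact F); exists t. Qed.

Variables (F : vert M -> Prop) (t : nat).
Hypothesis Ft : describes F t.

Lemma bit_fact j : bit t j -> fact F j.
Proof.
by case: Ft => tL FP /[dup] /(bit_lt tL)/FP jP /jP.
Qed.

Lemma alive_bitP (a : 'I_n) : alive_bit t a <-> exists v, F v /\ chi v = a.
Proof.
split=> [/bit_fact|aF]; last by apply/(proj2 Ft); [apply: nbits_bound0 | constructor 1; exists a].
case=> [[b]|[p [b]]|[e [phi]]|[e [phi]]] [/cpair_inj[] //].
by move=> _ /val_inj->.
Qed.

Lemma val_bitP p (a : 'I_n) : p < N ->
  val_bit t p a <-> exists v, F v /\ lab p v /\ chi v = a.
Proof.
move=> pN; split=> [/bit_fact|aF]; last first.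
  apply/(proj2 Ft); last by constructor 2; exists p, a.
  by apply: nbits_bound => //; [apply: bound_code | apply: bound_agent].
case=> [[b]|[q [b]]|[e [phi]]|[e [phi]]] [/cpair_inj[] //].
by move=> _ /cpair_inj[-> /val_inj->].
Qed.

Lemma pos_bitW e i : pos_bit t e i ->
  exists2 phi : form n, i = enc phi & sat F (assignment e) phi.
Proof.
move/bit_fact; case=> [[b]|[q [b]]|[e' [phi]]|[e' [phi]]] [/cpair_inj[] //].
by move=> _ /cpair_inj[-> ->]; exists phi.
Qed.

Lemma neg_bitW e i : neg_bit t e i ->
  exists2 phi : form n, i = enc phi & ~ sat F (assignment e) phi.
Proof.
move/bit_fact; case=> [[b]|[q [b]]|[e' [phi]]|[e' [phi]]] [/cpair_inj[] //].
by move=> _ /cpair_inj[-> ->]; exists phi.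
Qed.

Lemma pos_bitI e phi : e < n ^ N -> enc phi < N -> sat F (assignment e) phi ->
  pos_bit t e (enc phi).
Proof.
move=> eE fN sF; apply/(proj2 Ft); last by constructor 3; exists e, phi.
by apply: nbits_bound => //; [apply: bound_assignment | apply: bound_code].
Qed.

Lemma neg_bitI e phi : e < n ^ N -> enc phi < N -> ~ sat F (assignment e) phi ->
  neg_bit t e (enc phi).
Proof.
move=> eE fN sF; apply/(proj2 Ft); last by constructor 4; exists e, phi.
by apply: nbits_bound => //; [apply: bound_assignment | apply: bound_code].
Qed.

End Types.

Lemma enc_pred (phi : form n) p x : cpair 0 (cpair p x) = enc phi -> phi = fPred n p x.
Proof. by case: phi => [q y||f|f g|y b f|Y f] /cpair_inj[] // _ /cpair_inj[-> ->]. Qed.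

Lemma enc_top (phi : form n) : cpair 1 0 = enc phi -> phi = fTop.
Proof. by case: phi => [q y||f|f g|y b f|Y f] /cpair_inj[]. Qed.

Lemma enc_neg (phi : form n) i : cpair 2 i = enc phi ->
  exists2 f, phi = fNeg f & i = enc f.
Proof. by case: phi => [q y||f|f g|y b f|Y f] /cpair_inj[] // _ ->; exists f. Qed.

Lemma enc_and (phi : form n) i j : cpair 3 (cpair i j) = enc phi ->
  exists f g, [/\ phi = fAnd f g, i = enc f & j = enc g].
Proof.
by case: phi => [q y||f|f g|y b f|Y f] /cpair_inj[] // _ /cpair_inj[-> ->]; exists f, g.
Qed.

Lemma enc_assign (phi : form n) x a i : cpair 4 (cpair x (cpair a i)) = enc phi ->
  exists (b : 'I_n) f, [/\ phi = fAssign x b f, a = b & i = enc f].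
Proof.
case: phi => [q y||f|f g|y b f|Y f] /cpair_inj[] // _ /cpair_inj[-> /cpair_inj[-> ->]].
by exists b, f.
Qed.

Lemma enc_K (phi : form n) i j : cpair 5 (cpair i j) = enc phi ->
  exists X f, [/\ phi = fK X f, i = enc_list X & j = enc f].
Proof.
by case: phi => [q y||f|f g|y b f|Y f] /cpair_inj[] // _ /cpair_inj[-> ->]; exists Y, f.
Qed.

Lemma for_varsP e X (Q : nat -> Prop) : enc_list X < N ->
  for_vars n N e (enc_list X) Q <-> forall x, x \in X -> Q (assignment e x).
Proof.
move=> XN; split=> [fQ x xX|fQ x xN /mem_codeP]; last by move/(_ XN)/fQ.
by apply: fQ; [apply: ltn_trans XN; apply: mem_enc_list | apply/mem_codeP].
Qed.

Lemma facet_sub (M : simplicial_model n) (F G : vert M -> Prop) :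
  facet F -> facet G -> (forall v, F v -> G v) -> F = G.
Proof.
move=> [_ maxF] [sG _] FG; apply: functional_extensionality => v.
by apply: propositional_extensionality; split; [apply: FG | apply: maxF].
Qed.

(** A shared vertex carries the same atoms in both facets, and knowledge of a group depends only on
    the vertices of its agents. [half] is one direction of the equivalences and is used both
    ways. *)
Lemma agree_codeP (M : simplicial_model n) (F G : vert M -> Prop) t u B :
  facet F -> facet G -> describes F t -> describes G u ->
  (forall a : 'I_n, bit B a -> exists v, F v /\ G v /\ chi v = a) ->
  agree_code n N B t u.
Proof.
have half F' G' t' u' : facet F' -> facet G' -> describes F' t' -> describes G' u' ->
    (forall a : 'I_n, bit B a -> exists v : vert M, F' v /\ G' v /\ chi v = a) ->
    (forall p (a : 'I_n), p < N -> bit B a -> val_bit t' p a -> val_bit u' p a) /\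
    (forall e X f, X < N -> for_vars n N e X (fun a => bit B a) ->
      pos_bit t' e (cpair 5 (cpair X f)) -> pos_bit u' e (cpair 5 (cpair X f))).
  move=> fF' fG' Ft' Gu' sh; split.
    move=> p a pN /sh[v [Fv [Gv <-]]] /(val_bitP Ft' _ pN)[w [Fw [pw e]]].
    apply/(val_bitP Gu') => //; exists v; do 2!split=> //.
    by rewrite -(chi_inj (proj1 fF') Fw Fv e).
  move=> e i j iN XB /[dup] /(bit_lt (proj1 Ft')) idx /(pos_bitW Ft')[phi e_phi].
  have [X [f [def_phi eX ef]]] := enc_K e_phi; subst i; rewrite def_phi /= => sK.
  apply/(proj2 Gu') => //; constructor 3; exists e, phi.
  rewrite -e_phi def_phi; split=> //= G0 fG0 sh0; apply: sK => // x xX.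
  have [v [Fv [Gv ev]]] := sh _ (proj1 (for_varsP e _ iN) XB _ xX).
  have [w [Gw [G0w ew]]] := sh0 _ xX; exists v; do 2!split=> //.
  by rewrite -(chi_inj (proj1 fG') Gw Gv) // ev ew.
move=> fF fG Ft Gu sh.
have sh' (a : 'I_n) : bit B a -> exists v, G v /\ F v /\ chi v = a.
  by move=> /sh[v [? []]]; exists v.
have [val1 pos1] := half _ _ _ _ fF fG Ft Gu sh.
have [val2 pos2] := half _ _ _ _ fG fF Gu Ft sh'.
split; [|split].
- move=> a an /(sh (Ordinal an))[v [Fv [Gv ev]]].
  by split; [apply/(alive_bitP Ft (Ordinal an)) | apply/(alive_bitP Gu (Ordinal an))]; exists v.
- by move=> p pN a an aB; split; [apply: (val1 p (Ordinal an)) | apply: (val2 p (Ordinal an))].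
- by move=> e eE X XN f fN XB; split; [apply: pos1 | apply: pos2].
Qed.

(** If all agents alive in one facet were in [B], that facet would be included in the other, and
    maximality would make them equal. *)
Lemma edge_codeP (M : simplicial_model n) (F G : vert M -> Prop) t u B :
  facet F -> facet G -> F <> G -> describes F t -> describes G u ->
  (forall a : 'I_n, bit B a -> exists v, F v /\ G v /\ chi v = a) ->
  edge_code n N B t u.
Proof.
move=> fF fG neqFG Ft Gu sh.
have outside F' G' t' : facet F' -> facet G' -> F' <> G' -> describes F' t' ->
    (forall a : 'I_n, bit B a -> exists v : vert M, F' v /\ G' v /\ chi v = a) ->
    exb n (fun a => alive_bit t' a /\ ~ bit B a).
  move=> fF' fG' neq Ft' sh'; apply: NNPP => nout; apply: neq.
  apply: facet_sub => // v Fv.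
  have /sh'[w [Fw [Gw ew]]] : bit B (chi v).
    apply: NNPP => nB; apply: nout; exists (chi v) => //; split=> //.
    by apply/(alive_bitP Ft'); exists v.
  by rewrite -(chi_inj (proj1 fF') Fw Fv ew).
split; first exact: outside fF fG neqFG Ft sh.
split; last exact: agree_codeP fF fG Ft Gu sh.
apply: outside fG fF (nesym neqFG) Gu _ => a /sh[v [? []]].
by exists v.
Qed.

Lemma saturated_codeP (M : simplicial_model n) (F : vert M -> Prop) t T :
  facet F -> describes F t ->
  (forall (G : vert M -> Prop) u, facet G -> describes G u -> bit T u) ->
  saturated_code n N T t.
Proof.
move=> fF Ft TP; split.
  have [v Fv] := simp_nonempty (proj1 fF).
  by exists (chi v) => //; apply/(alive_bitP Ft); exists v.
move=> e eE; split.
  by move=> /(neg_bitW Ft)[phi /enc_top->] /=; apply.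
split.
  move=> p pN x xN; split.
    move=> /(pos_bitW Ft)[phi /enc_pred-> /= [v [Fv [pv ev]]]].
    split; first by apply/(alive_bitP Ft (assignment e x)); exists v.
    by apply/(val_bitP Ft (assignment e x)) => //; exists v.
  move=> /(neg_bitW Ft)[phi /enc_pred-> /= nsat] _ vl; apply: nsat.
  by apply/(val_bitP Ft (assignment e x)).
move=> i iN; split.
  move=> /(pos_bitW Ft)[phi /enc_neg[f -> ei] /= nf].
  by rewrite ei; apply: (neg_bitI Ft); rewrite // -ei.
split.
  move=> /(neg_bitW Ft)[phi /enc_neg[f -> ei] /= /NNPP nf].
  by rewrite ei; apply: (pos_bitI Ft); rewrite // -ei.
split.
  move=> j jN; split.
    move=> /(pos_bitW Ft)[phi /enc_and[f [g [-> ei ej]]] /= [sf sg]].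
    by rewrite ei ej; split; apply: (pos_bitI Ft); rewrite // -?ei -?ej.
  move=> /(neg_bitW Ft)[phi /enc_and[f [g [-> ei ej]]] /= /not_and_or[sf|sg]].
    by left; rewrite ei; apply: (neg_bitI Ft); rewrite // -ei.
  by right; rewrite ej; apply: (neg_bitI Ft); rewrite // -ej.
split.
  move=> x xN a an e' eE' /(upd_codeP (Ordinal an) xN eE eE') ue; split.
    move=> /(pos_bitW Ft)[phi /enc_assign[b [f [-> eb ei]]] /= sf] al.
    have {}eb : Ordinal an = b by apply: val_inj.
    rewrite ei; apply: (pos_bitI Ft); rewrite -?ei // ue eb; apply: sf.
    by move/(alive_bitP Ft (Ordinal an)): al; rewrite eb.
  move=> /(neg_bitW Ft)[phi /enc_assign[b [f [-> eb ei]]] /= nsf].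
  have {}eb : Ordinal an = b by apply: val_inj.
  have [al nf] := imply_to_and _ _ nsf.
  split; first by apply/(alive_bitP Ft (Ordinal an)); rewrite eb.
  by rewrite ei; apply: (neg_bitI Ft); rewrite -?ei // ue eb.
move=> k kN; split.
  move=> /(pos_bitW Ft)[phi /enc_K[X [f [-> eX ei]]] /= sK] al.
  rewrite ei; apply: (pos_bitI Ft); rewrite -?ei //; apply: sK => // x xX.
  move: al; rewrite eX => /for_varsP; rewrite -eX => /(_ kN x xX).
  by case/(alive_bitP Ft) => v [Fv ev]; exists v.
move=> /(neg_bitW Ft)[phi /enc_K[X [f [-> eX ei]]] /= nK].
have [G nKG] := not_all_ex_not _ _ nK.
have [fG nKG1] := imply_to_and _ _ nKG.
have [sh nf] := imply_to_and _ _ nKG1.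
subst k i; split.
  apply/for_varsP => // x /sh[v [Fv [_ ev]]].
  by apply/(alive_bitP Ft); exists v.
(* A refuting facet equal to [F] admits no proper label; it is covered by the local alternative. *)
have [FG|neqFG] := classic (F = G).
  by left; rewrite FG in Ft; exact: (neg_bitI Ft).
right; have [u Gu] := describes_exists G.
exists u; first exact: proj1 Gu.
split; first exact: TP fG Gu.
split; first exact: (neg_bitI Gu).
(* The label is the set of values of [X], whose vertices the semantics makes shared by [F] and
   [G]. *)
have [B B_lt BP] := bits_exist n (fun a => exists2 x, x \in X & a = assignment e x).
exists B => //; split.
  by apply/for_varsP => // x xX; apply/BP => //; exists x.
apply: edge_codeP fF fG neqFG Ft Gu _ => a /BP[//|x xX /val_inj->].
exact: sh.
Qed.

End Decode.

(** * Coded satisfiability is satisfiability *)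

Lemma satisfiable_code_complete n (n_gt0 : 0 < n) (alpha : form n) :
  satisfiable alpha -> satisfiable_code n (enc alpha).
Proof.
move=> [M [F [fF sF]]]; set N := (enc alpha).+1.
(* The types of all facets of [M] form a finite set even when [M] is infinite. *)
have [T T_lt TP] := bits_exist (2 ^ nbits n N)
  (fun t => exists G : vert M -> Prop, facet G /\ describes N n_gt0 G t).
exists T => //; split.
  have [t Ft] := describes_exists N n_gt0 F.
  exists t; first exact: proj1 Ft.
  split; first by apply/TP; [exact: proj1 Ft | exists F].
  by move=> e eE; apply: (pos_bitI Ft).
move=> t t_lt /TP[//|G [fG Gt]]; apply: (saturated_codeP fG Gt) => G' u fG' Gu.
by apply/TP; [exact: proj1 Gu | exists G'].
Qed.

(** The guards [p < N] and [enc phi < N] keep only the entries that the coded conditions constrain.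
    An assignment enters through any code that agrees with it below [N]. *)
Definition code_hintikka (n N : nat) : hintikka n := {|
  state := nat;
  alive t a := alive_bit t a;
  atom t p a := p < N /\ val_bit t p a;
  pos t s phi := enc phi < N /\ exists2 e, e < n ^ N &
    (forall x, x < N -> digit n e x = s x) /\ pos_bit t e (enc phi);
  neg t s phi := enc phi < N /\ exists2 e, e < n ^ N &
    (forall x, x < N -> digit n e x = s x) /\ neg_bit t e (enc phi)
|}.

Definition agents_of (n B : nat) : seq 'I_n := [seq a <- enum 'I_n | bit B (a : 'I_n)].

Lemma mem_agents_of n B (a : 'I_n) : (a \in agents_of n B) = bit B a.
Proof. by rewrite mem_filter mem_enum andbT. Qed.

Lemma for_vars_agree n N e (s : nat -> 'I_n) X (Q : nat -> Prop) :
  (forall x, x < N -> digit n e x = s x) -> enc_list X < N ->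
  for_vars n N e (enc_list X) Q <-> forall x, x \in X -> Q (s x).
Proof.
move=> es XN; split=> [fQ x xX|fQ x xN /mem_codeP]; last first.
  by move/(_ XN)/fQ; rewrite es.
have xN : x < N by apply: ltn_trans XN; apply: mem_enc_list.
by rewrite -es //; apply: fQ => //; apply/mem_codeP.
Qed.

Lemma agree_code_hintikka n N B t u : agree_code n N B t u ->
  agree (H := code_hintikka n N) (agents_of n B) t u.
Proof.
move=> [al [va po]]; split=> [a|p a|s X f sXB].
- by rewrite mem_agents_of; apply: al.
- by rewrite mem_agents_of => aB; split=> -[pN] /(va _ pN _ (ltn_ord a) aB).
have fv e : enc_list X < N -> (forall x, x < N -> digit n e x = s x) ->
    for_vars n N e (enc_list X) (fun a => bit B a).
  by move=> XN es; apply/(for_vars_agree _ es XN) => x /sXB; rewrite mem_agents_of.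
by split=> -[/[dup] KN /cpair_lt[_ /cpair_lt[XN fN]]] [e eE [es b]]; split=> //;
  exists e => //; split=> //; apply/(po e eE _ XN _ fN (fv _ XN es)).
Qed.

Lemma edge_code_hintikka n N B t u : edge_code n N B t u ->
  edge (H := code_hintikka n N) (agents_of n B) t u.
Proof.
move=> [[a an [al naB]] [[b bn [bl nbB]] /agree_code_hintikka ag]]; split=> //.
  by exists (Ordinal an) => //; rewrite mem_agents_of; apply/negP.
by exists (Ordinal bn) => //; rewrite mem_agents_of; apply/negP.
Qed.

Lemma upd_code_exists n N e (s : nat -> 'I_n) x (a : 'I_n) :
  (forall y, y < N -> digit n e y = s y) ->
  exists2 e', e' < n ^ N & upd_code n N e e' x a /\
    forall y, y < N -> digit n e' y = upd s x a y.
Proof.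
move=> es.
have [e' eE' e's] := assignment_exists N (upd s x a).
exists e' => //; split=> // y yN; rewrite (e's _ yN) /upd.
by case: PeanoNat.Nat.eqb_spec => yx; [left | right; rewrite es].
Qed.

(** Clause by clause, with [cpair_lt] bounding the components of a formula and [upd_code_exists]
    providing a code for the updated assignment. *)
Lemma code_saturated n N T :
  allb (2 ^ nbits n N) (fun t => bit T t -> saturated_code n N T t) ->
  saturated (H := code_hintikka n N) (fun t => t < 2 ^ nbits n N /\ bit T t).
Proof.
move=> satT; split=> t.
- by move=> [tL /(satT _ tL)[[a an al] _]]; exists (Ordinal an).
- move=> s p x [tL /(satT _ tL)[_ sat_t]] [/cpair_lt[_ /cpair_lt[pN xN]] [e eE [es b]]] /=.
  have [_ [/(_ p pN x xN)[+ _] _]] := sat_t e eE.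
  by rewrite es // => /(_ b)[].
- move=> s p x [tL /(satT _ tL)[_ sat_t]] [/cpair_lt[_ /cpair_lt[pN xN]] [e eE [es b]]] al [_] /=.
  have [_ [/(_ p pN x xN)[_ +] _]] := sat_t e eE.
  by rewrite es // => /(_ b al).
- move=> s [tL /(satT _ tL)[_ sat_t]] [_ [e eE [es b]]].
  by have [] := sat_t e eE.
- move=> s f [tL /(satT _ tL)[_ sat_t]] [/cpair_lt[_ fN] [e eE [es b]]].
  split=> //; exists e => //; split=> //.
  by have [_ [_ /(_ _ fN)[+ _]]] := sat_t e eE; apply.
- move=> s f [tL /(satT _ tL)[_ sat_t]] [/cpair_lt[_ fN] [e eE [es b]]].
  split=> //; exists e => //; split=> //.
  by have [_ [_ /(_ _ fN)[_ [+ _]]]] := sat_t e eE; apply.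
- move=> s f g [tL /(satT _ tL)[_ sat_t]] [/cpair_lt[_ /cpair_lt[fN gN]] [e eE [es b]]].
  have [_ [_ /(_ _ fN)[_ [_ [/(_ _ gN)[/(_ b)[bf bg] _] _]]]]] := sat_t e eE.
  by split; split=> //; exists e.
- move=> s f g [tL /(satT _ tL)[_ sat_t]] [/cpair_lt[_ /cpair_lt[fN gN]] [e eE [es b]]].
  have [_ [_ /(_ _ fN)[_ [_ [/(_ _ gN)[_ /(_ b)[bf|bg]] _]]]]] := sat_t e eE.
    by left; split=> //; exists e.
  by right; split=> //; exists e.
- move=> s x a f [tL /(satT _ tL)[_ sat_t]].
  move=> [/cpair_lt[_ /cpair_lt[xN /cpair_lt[_ fN]]] [e eE [es b]]] al.
  split=> //; have [e' eE' [ue e's]] := upd_code_exists x a es.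
  exists e' => //; split=> //.
  have [_ [_ /(_ _ fN)[_ [_ [_ [+ _]]]]]] := sat_t e eE.
  by move=> /(_ _ xN _ (ltn_ord a) _ eE' ue)[+ _]; apply.
- move=> s x a f [tL /(satT _ tL)[_ sat_t]].
  move=> [/cpair_lt[_ /cpair_lt[xN /cpair_lt[_ fN]]] [e eE [es b]]].
  have [e' eE' [ue e's]] := upd_code_exists x a es.
  have [_ [_ /(_ _ fN)[_ [_ [_ [+ _]]]]]] := sat_t e eE.
  move=> /(_ _ xN _ (ltn_ord a) _ eE' ue)[_ /(_ b)[al bf]].
  by split=> //; split=> //; exists e'.
- move=> s X f [tL /(satT _ tL)[_ sat_t]].
  move=> [/cpair_lt[_ /cpair_lt[XN fN]] [e eE [es b]]] al.
  split=> //; exists e => //; split=> //.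
  have [_ [_ /(_ _ fN)[_ [_ [_ [_ /(_ _ XN)[+ _]]]]]]] := sat_t e eE.
  by apply=> //; apply/(for_vars_agree _ es XN).
- move=> s X f [tL /(satT _ tL)[_ sat_t]].
  move=> [/cpair_lt[_ /cpair_lt[XN fN]] [e eE [es b]]].
  have [_ [_ /(_ _ fN)[_ [_ [_ [_ /(_ _ XN)[_ /(_ b)[al wit]]]]]]]] := sat_t e eE.
  split; first exact: (proj1 (for_vars_agree _ es XN) al).
  case: wit => [bf|[u uL [Tu [bu [B BL [XB eB]]]]]].
    by left; split=> //; exists e.
  right; exists u, (agents_of n B); split=> //; last exact: edge_code_hintikka.
    by split=> //; exists e.
  by move=> x xX; rewrite mem_agents_of; apply: (proj1 (for_vars_agree _ es XN) XB).
Qed.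

Lemma satisfiable_code_sound n (alpha : form n) :
  satisfiable_code n (enc alpha) -> satisfiable alpha.
Proof.
move=> [T _ [[t tL [Tt alphat]] /code_saturated satT]].
apply: (saturated_satisfiable satT (conj tL Tt)) => s; split=> //.
have [e eE es] := assignment_exists (enc alpha).+1 s.
by exists e => //; split=> //; apply: alphat.
Qed.

Theorem theorem4 (n : nat) (Hn : 0 < n) :
  exists d : recf, forall alpha : form n, is_sentence alpha ->
    (eval d [:: enc alpha] 1 <-> satisfiable alpha) /\
    (eval d [:: enc alpha] 0 <-> ~ satisfiable alpha).
Proof.
have [b [d db] bP] := satisfiable_code_dec n.
exists d => alpha _; have {db} := db (fun=> enc alpha).
have : satisfiable alpha <-> b (fun=> enc alpha).
  rewrite -bP; split; first exact: satisfiable_code_complete.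
  exact: satisfiable_code_sound.
(* The algorithm outputs the truth value of satisfiability, and determinism excludes the other
   output. *)
have det := eval_det; rewrite /mkseq /=; case: (b _) => -> Ed.
  by split; split=> // /(det _ _ _ _ Ed).
by split; split=> // /(det _ _ _ _ Ed).
Qed.
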